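(* Let $G$ be an infinite finitely generated group. The subgroup membership problem of $G$ many-one reduces to $\mathrm{co}2\text{-}\mathrm{SAT}(G)$, the complement of the $2$-SAT problem over $G$.
   Context: Let $S$ be a finite generating set of $G$; a word $w\in(S\cup S^{-1})^*$ evaluates to an element $\bar w\in G$. Subgroup membership problem of $G$: given words $u,w_1,\dots,w_n\in (S\cup S^{-1})^*$, determine whether $\bar u\in\langle \bar w_1,\dots,\bar w_n\rangle$. $k$-SAT over $G$ ($k>1$): Boolean variables are the elements of $G$; for $g\in G$, $g'$ denotes either the literal $g$ or its negation $\neg g$. An input formula is $\phi=\bigwedge_{i=1}^m (v_{i1}'\vee\dots\vee v_{ik}')$ with $v_{ij}\in (S\cup S^{-1})^*$, where each $'$ indicates a fixed choice of negated or non-negated; its evaluation is $\bar\phi=\bigwedge_{i=1}^m (\bar v_{i1}'\vee\dots\vee \bar v_{ik}')$. For $h\in G$, $\bar\phi(h)$ is the formula obtained from $\bar\phi$ by left-multiplying every variable by $h$, i.e. $\bigwedge_{i=1}^m ((h\bar v_{i1})'\vee\dots\vee (h\bar v_{ik})')$ with the same negations. The $k$-SAT problem over $G$, denoted $k\text{-}\mathrm{SAT}(G)$, is: given an input formula $\phi$ and words $w_1,\dots,w_n\in(S\cup S^{-1})^*$, determine whether $\bigwedge_{h\in H}\bar\phi(h)$ is satisfiable, where $H=\langle \bar w_1,\dots,\bar w_n\rangle$; that is, whether there is an assignment $\alpha:G\to\{0,1\}$ making every clause of $\bar\phi(h)$ true for every $h\in H$. (The choice of $S$ is immaterial, since inputs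 can be computably rewritten in another generating set.) The complement $\mathrm{co}D$ of a decision problem $D$ is the set of all no instances of $D$. $L$ many-one reduces to $L'$ if there is a computable function $f$ with $w\in L\iff f(w)\in L'$ for every $w$. *)

(* Defs.v *)
From mathcomp Require Import all_boot.
From mathcomp Require Import finmap.
From mathcomp Require Import boolp classical_sets functions cardinality.

Set Implicit Arguments.
Unset Strict Implicit.
Unset Printing Implicit Defensive.

Local Open Scope classical_set_scope.

(* The total recursive functions, in Kleene's presentation: [rec_mu] minimises
   [f] in its first argument, and applies only when [f] is regular, i.e. when
   a zero exists for every value of the remaining arguments; [g] is then the
   least-zero function. *)
Inductive recursive : forall n, (n.-tuple nat -> nat) -> Prop :=
| rec_zero : recursive (fun _ : 0.-tuple nat => 0)
| rec_succ : recursive (fun v : 1.-tuple nat => (thead v).+1)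
| rec_proj n (i : 'I_n) : recursive (fun v : n.-tuple nat => tnth v i)
| rec_comp m n (f : m.-tuple nat -> nat) (g : 'I_m -> n.-tuple nat -> nat) :
    recursive f -> (forall i, recursive (g i)) ->
    recursive (fun v => f [tuple g i v | i < m])
| rec_primrec n (f : n.-tuple nat -> nat) (g : n.+2.-tuple nat -> nat) :
    recursive f -> recursive g ->
    recursive (fun v : n.+1.-tuple nat =>
      iteri (thead v) (fun k r => g [tuple of k :: r :: behead v])
            (f [tuple of behead v]))
| rec_mu n (f : n.+1.-tuple nat -> nat) (g : n.-tuple nat -> nat) :
    recursive f ->
    (forall v, f [tuple of g v :: v] = 0
            /\ forall y, y < g v -> f [tuple of y :: v] <> 0) ->
    recursive g.

(* Instances are coded by natural numbers through [pickle]. On products,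
   sequences, tuples and booleans this is an explicit effective Goedel
   numbering built from [CodeSeq.code]; on a finite alphabet it is a fixed
   numbering of the letters, whose choice does not affect computability. *)
Definition computable (A B : countType) (f : A -> B) : Prop :=
  exists2 phi : 1.-tuple nat -> nat,
    recursive phi & forall a, phi [tuple choice.pickle a] = choice.pickle (f a).

(* A decision problem is the set of its yes instances in the type of all its
   instances; its complement is then the set complement. *)
Definition problem (A : countType) := set A.

Definition co (A : countType) (D : problem A) : problem A := ~` D.

Definition many_one_reduces (A B : countType) (L : problem A) (L' : problem B) :
    Prop :=
  exists2 f : A -> B, computable f & forall w, L w <-> L' (f w).

Definition is_subgroup (G : groupType) (H : set G) : Prop :=
  [/\ H 1%g,
      forall x y, H x -> H y -> H (x * y)%g
    & forall x, H x -> H (x^-1)%g].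

Definition generated (G : groupType) (X : set G) : set G :=
  smallest (@is_subgroup G) X.

Definition generates (G : groupType) (S : {fset G}) : Prop :=
  generated [set` S] = [set: G].

Section Words.
Variables (G : groupType) (S : {fset G}).

Definition letters : {fset G} := (S `|` [fset (x^-1)%g | x in S])%fset.

Definition word := seq letters.

Definition evalw (w : word) : G := (\prod_(x <- w) val x)%g.

Definition subgroup_of (ws : seq word) : set G :=
  generated [set` [seq evalw w | w <- ws]].

Definition membership_instance := (word * seq word)%type.

Definition subgroup_membership : problem membership_instance :=
  [set I | subgroup_of I.2 (evalw I.1)].

End Words.

(* [(true, v)] is the literal v and [(false, v)] its negation. *)
Definition literal (V : Type) := (bool * V)%type.

Definition clause (k : nat) (V : Type) := k.-tuple (literal V).

(* The conjunction of a finite list of clauses with exactly k literals;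
   repetitions within a clause are allowed. *)
Definition cnf (k : nat) (V : Type) := seq (clause k V).

Definition map_cnf (k : nat) (V W : Type) (f : V -> W) (phi : cnf k V) :
    cnf k W :=
  [seq [tuple of [seq (l.1, f l.2) | l <- c]] | c : clause k V <- phi].

Definition lit_true (V : Type) (alpha : V -> bool) (l : literal V) : bool :=
  alpha l.2 == l.1.

Definition cnf_true (k : nat) (V : Type) (alpha : V -> bool) (phi : cnf k V) :
    bool :=
  all (fun c : clause k V => has (lit_true alpha) c) phi.

Section KSat.
Variables (k : nat) (G : groupType) (S : {fset G}).

Definition eval_cnf (phi : cnf k (word S)) : cnf k G := map_cnf (@evalw G S) phi.

Definition translate (h : G) (psi : cnf k G) : cnf k G :=
  map_cnf (fun g => h * g)%g psi.

Definition ksat_instance := (cnf k (word S) * seq (word S))%type.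

Definition ksat : problem ksat_instance :=
  [set I | exists alpha : G -> bool,
     forall h, subgroup_of I.2 h -> cnf_true alpha (translate h (eval_cnf I.1))].

End KSat.

Arguments subgroup_membership {G} S.
Arguments ksat k {G} S.

(* Main.v *)
(** The formula [x /\ ~ (x u)] with [x] ranging over [H] demands that every
    variable of [H] be true and every variable of [H u] be false, hence it is
    satisfiable exactly when [H] and [H u] are disjoint, that is, when [u] is
    not in [H]. On codes, the reduction maps the code [2 ^ a * (2 * 2 ^ b + 1)]
    of a pair [(a, b)] to an arithmetic expression in [a] and [b]; the two
    components are recovered from the sum [2 ^ (a + b + 1) + 2 ^ a] by rounded
    binary logarithms. *)
Require Import Defs.
From mathcomp Require Import all_boot.
From mathcomp Require Import finmap.
From mathcomp Require Import boolp classical_sets functions cardinality.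

Set Implicit Arguments.
Unset Strict Implicit.
Unset Printing Implicit Defensive.

(** * Closure properties of the recursive functions *)

Lemma eq_recursive n (f g : n.-tuple nat -> nat) :
  f =1 g -> recursive f -> recursive g.
Proof. by move=> /funext ->. Qed.

Lemma recursive_const n c : recursive (fun _ : n.-tuple nat => c).
Proof.
elim: c => [|c IHc].
  (* The nullary zero is composed with the empty family; [i] lies in ['I_0], so any [g] serves. *)
  apply: (eq_recursive _ (rec_comp rec_zero (g := fun i _ => i : nat) _)) => //.
  by case.
apply: (eq_recursive _ (rec_comp rec_succ (g := fun _ _ => c) (fun=> IHc))) => v.
by rewrite /thead tnth_mktuple.
Qed.

(* An index [i >= n] is allowed: it gives the default value [0]. *)
Lemma recursive_nth n i : recursive (fun v : n.-tuple nat => nth 0 v i).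
Proof.
have [lt_in | le_ni] := ltnP i n.
  apply: (eq_recursive _ (rec_proj (Ordinal lt_in))) => v.
  by rewrite (tnth_nth 0).
apply: (eq_recursive _ (recursive_const n 0)) => v.
by rewrite nth_default ?size_tuple.
Qed.

Definition recursive1 (h : nat -> nat) :=
  recursive (fun v : 1.-tuple nat => h (nth 0 v 0)).

Definition recursive2 (h : nat -> nat -> nat) :=
  recursive (fun v : 2.-tuple nat => h (nth 0 v 0) (nth 0 v 1)).

Lemma recursive_comp1 n (h : nat -> nat) (f : n.-tuple nat -> nat) :
  recursive1 h -> recursive f -> recursive (fun v => h (f v)).
Proof.
move=> rh rf.
apply: (eq_recursive _ (rec_comp rh (g := fun=> f) (fun=> rf))) => v.
by rewrite -(tnth_nth 0 _ ord0) tnth_mktuple.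
Qed.

Lemma recursive_comp2 n (h : nat -> nat -> nat) (f g : n.-tuple nat -> nat) :
  recursive2 h -> recursive f -> recursive g ->
  recursive (fun v => h (f v) (g v)).
Proof.
move=> rh rf rg; pose F (i : 'I_2) := if i == ord0 then f else g.
have rF i : recursive (F i) by rewrite /F; case: ifP.
apply: (eq_recursive _ (rec_comp rh rF)) => v.
by rewrite -(tnth_nth 0 _ ord0) -(tnth_nth 0 _ (@Ordinal 2 1 isT)) !tnth_mktuple.
Qed.

Lemma recursive1_iteri (g : nat -> nat -> nat) a :
  recursive2 g -> recursive1 (fun m => iteri m g a).
Proof.
move=> rg.
apply: (eq_recursive _ (rec_primrec (recursive_const 0 a) rg)) => v.
by rewrite /thead (tnth_nth 0).
Qed.

Lemma recursive2_iter (g : nat -> nat -> nat) (f : nat -> nat) :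
  recursive1 f -> recursive2 g ->
  recursive2 (fun m n => iter m (g n) (f n)).
Proof.
move=> rf rg.
(* The step function receives counter, previous value and parameter in positions 0, 1, 2; the
   counter is ignored. *)
have rg3 := recursive_comp2 rg (recursive_nth 3 2) (recursive_nth 3 1).
apply: (eq_recursive _ (rec_primrec rf rg3)) => v.
rewrite /thead (tnth_nth 0) /= nth_behead.
by elim: (nth 0 v 0) => //= m ->; rewrite nth_behead.
Qed.

Lemma recursive1_mu (P : nat -> nat -> nat) (g : nat -> nat) :
  recursive2 P ->
  (forall n, P (g n) n = 0 /\ forall y, y < g n -> P y n <> 0) ->
  recursive1 g.
Proof. by move=> rP Pg; apply: (rec_mu rP) => v; exact: Pg. Qed.

(** * Recursiveness of the arithmetic operations *)

Lemma recursive1_succn : recursive1 succn.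
Proof. by apply: (eq_recursive _ rec_succ) => v; rewrite /thead (tnth_nth 0). Qed.

Lemma recursive2_addn : recursive2 addn.
Proof.
have := recursive2_iter (g := fun=> succn) (f := id) (recursive_nth 1 0)
          (recursive_comp1 recursive1_succn (recursive_nth 2 1)).
by apply: eq_recursive => v; rewrite iter_succn addnC.
Qed.

Lemma recursive1_predn : recursive1 predn.
Proof.
(* The step returns its counter, whose last value is the predecessor. *)
apply: (eq_recursive _ (recursive1_iteri (g := fun k _ => k) 0 _)) => [v|].
  by case: (nth 0 v 0).
exact: recursive_nth.
Qed.

Lemma recursive2_subn : recursive2 subn.
Proof.
have riter := recursive2_iter (g := fun=> predn) (f := id) (recursive_nth 1 0)
                (recursive_comp1 recursive1_predn (recursive_nth 2 1)).
have := recursive_comp2 riter (recursive_nth 2 1) (recursive_nth 2 0).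
by apply: eq_recursive => v; rewrite iter_predn.
Qed.

Lemma recursive2_muln : recursive2 muln.
Proof.
have := recursive2_iter (f := fun=> 0) (recursive_const 1 0) recursive2_addn.
by apply: eq_recursive => v; rewrite iter_addn_0 mulnC.
Qed.

Lemma recursive1_expn2 : recursive1 (expn 2).
Proof.
have := recursive1_iteri (g := fun _ r => 2 * r) 1
  (recursive_comp2 recursive2_muln (recursive_const 2 2) (recursive_nth 2 1)).
by apply: eq_recursive => v; elim: (nth 0 v 0) => //= n ->; rewrite expnS.
Qed.

(** By truncated subtraction [n - 2 ^ y] vanishes exactly when [n <= 2 ^ y], and [up_log 2 n] is the
    least such [y]. *)
Lemma recursive1_up_log2 : recursive1 (up_log 2).
Proof.
apply: (recursive1_mu (P := fun y n => n - 2 ^ y)) => [|n].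
  exact: recursive_comp2 recursive2_subn (recursive_nth 2 1)
           (recursive_comp1 recursive1_expn2 (recursive_nth 2 0)).
split; first by apply/eqP; rewrite subn_eq0 up_logP.
move=> y lt_y /eqP; rewrite subn_eq0 => /(up_log_min (isT : 1 < 2)).
by rewrite leqNgt lt_y.
Qed.

(** * Codes of pairs and their decoding *)

(** One step of [CodeSeq.code]: head [n], tail already coded by [m]; the empty sequence has code
    0. *)
Definition cons_code n m := 2 ^ n * m.*2.+1.

Definition pair_code a b := cons_code a (cons_code b 0).

Lemma recursive2_cons_code : recursive2 cons_code.
Proof.
have := recursive_comp2 recursive2_muln
  (recursive_comp1 recursive1_expn2 (recursive_nth 2 0))
  (recursive_comp1 recursive1_succn
    (recursive_comp2 recursive2_addn (recursive_nth 2 1) (recursive_nth 2 1))).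
by apply: eq_recursive => v; rewrite addnn.
Qed.

Lemma recursive2_pair_code : recursive2 pair_code.
Proof.
exact: recursive_comp2 recursive2_cons_code (recursive_nth 2 0)
  (recursive_comp2 recursive2_cons_code (recursive_nth 2 1)
                   (recursive_const 2 0)).
Qed.

Lemma pair_codeE a b : pair_code a b = 2 ^ (a + b).+1 + 2 ^ a.
Proof.
rewrite /pair_code /cons_code muln1 mulnS addnC -mul2n mulnCA -expnD.
by rewrite -expnS.
Qed.

(** The code exceeds [2 ^ (a + b).+1] by [2 ^ a], which is positive and at most that power. *)
Lemma up_log2_pair_code a b : up_log 2 (pair_code a b) = (a + b).+2.
Proof.
apply: up_log_eq => //; rewrite pair_codeE -{1}[2 ^ _]addn0 ltn_add2l expn_gt0.
by rewrite /= [leqRHS]expnS mul2n -addnn leq_add2l leq_pexp2l // leqW ?leq_addr.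
Qed.

(** Removing the larger of the two powers of 2 in a pair code leaves [2 ^ a]. *)
Definition code_fst N := up_log 2 (N - 2 ^ (up_log 2 N).-1).

Definition code_snd N := up_log 2 N - (code_fst N).+2.

Lemma pair_codeK1 a b : code_fst (pair_code a b) = a.
Proof. by rewrite /code_fst up_log2_pair_code pair_codeE addKn up_expnK. Qed.

Lemma pair_codeK2 a b : code_snd (pair_code a b) = b.
Proof. by rewrite /code_snd pair_codeK1 up_log2_pair_code !subSS addKn. Qed.

Lemma recursive1_code_fst : recursive1 code_fst.
Proof.
exact: recursive_comp1 recursive1_up_log2
  (recursive_comp2 recursive2_subn (recursive_nth 1 0)
    (recursive_comp1 recursive1_expn2
      (recursive_comp1 recursive1_predn recursive1_up_log2))).
Qed.

Lemma recursive1_code_snd : recursive1 code_snd.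
Proof.
exact: recursive_comp2 recursive2_subn recursive1_up_log2
  (recursive_comp1 recursive1_succn
    (recursive_comp1 recursive1_succn recursive1_code_fst)).
Qed.

(** Holds by computation, since a pair is pickled as the two-element sequence of its components'
    codes. *)
Lemma pickle_pair (A B : countType) (x : A) (y : B) :
  choice.pickle (x, y) = pair_code (choice.pickle x) (choice.pickle y).
Proof. by []. Qed.

Lemma pickle_cons (A : countType) (x : A) (s : seq A) :
  choice.pickle (x :: s) = cons_code (choice.pickle x) (choice.pickle s).
Proof. by []. Qed.

Lemma pickle_tuple2 (A : countType) (x y : A) :
  choice.pickle [tuple x; y] = pair_code (choice.pickle x) (choice.pickle y).
Proof. by []. Qed.

(** * The reduction, its computability and its correctness *)

Section Reduction.
Variables (G : groupType) (S : {fset G}).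

(** The literal is doubled because a clause has exactly two entries. *)
Definition unit_clause (l : literal (word S)) : clause 2 (word S) :=
  [tuple l; l].

Definition disjointness_cnf (u : word S) : cnf 2 (word S) :=
  [:: unit_clause (true, [::]); unit_clause (false, u)].

Definition reduction (I : membership_instance S) : ksat_instance 2 S :=
  (disjointness_cnf I.1, I.2).

(** In [pair_code 0] the 0 is the code of [false]; the last 0 is the code of the empty list of
    clauses. *)
Lemma pickle_reduction u ws :
  choice.pickle (reduction (u, ws)) =
  pair_code
    (cons_code (choice.pickle (unit_clause (true, [::])))
      (cons_code (pair_code (pair_code 0 (choice.pickle u))
                            (pair_code 0 (choice.pickle u))) 0))
    (choice.pickle ws).
Proof. by rewrite pickle_pair !pickle_cons pickle_tuple2 pickle_pair. Qed.

Lemma computable_reduction : computable reduction.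
Proof.
(* From the code of [(u, ws)], this yields the code of the literal [(false, u)]. *)
have rlit := recursive_comp2 recursive2_pair_code (recursive_const 1 0)
               recursive1_code_fst.
have rphi := recursive_comp2 recursive2_pair_code
  (recursive_comp2 recursive2_cons_code
    (recursive_const 1 (choice.pickle (unit_clause (true, [::]))))
    (recursive_comp2 recursive2_cons_code
       (recursive_comp2 recursive2_pair_code rlit rlit) (recursive_const 1 0)))
  recursive1_code_snd.
apply: (ex_intro2 _ _ _ rphi) => -[u ws]; rewrite pickle_reduction.
have -> : nth 0 [tuple choice.pickle (u, ws)] 0 =
    pair_code (choice.pickle u) (choice.pickle ws) by rewrite -pickle_pair.
by rewrite pair_codeK1 pair_codeK2.
Qed.

(** An intersection of subgroups is a subgroup: each closure property is checked in every [K]. *)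
Lemma subgroup_of_is_subgroup (ws : seq (word S)) :
  is_subgroup (subgroup_of ws).
Proof.
split=> [K [[]] //|x y Hx Hy K KP|x Hx K KP].
  by case: (KP) => -[_ KM _] _; apply: KM; [exact: Hx | exact: Hy].
by case: (KP) => -[_ _ KV] _; apply: KV; exact: Hx.
Qed.

Lemma reductionP (I : membership_instance S) :
  subgroup_membership S I <-> co (ksat 2 S) (reduction I).
Proof.
case: I => u ws; have [H1 HM HV] := subgroup_of_is_subgroup ws.
have cnfE alpha h :
    cnf_true alpha (translate h (eval_cnf (disjointness_cnf u))) =
    alpha h && ~~ alpha (h * evalw u)%g.
  rewrite /cnf_true /lit_true /= !orbF !orbb /evalw big_nil mulg1.
  by rewrite eqb_id eqbF_neg andbT.
split=> [Hu [alpha sat]|unsat].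
  have {}sat h (Hh : subgroup_of ws h) : alpha h && ~~ alpha (h * evalw u)%g.
    by rewrite -cnfE; exact: sat.
  (* The first clause at [h = evalw u] makes [evalw u] true; the second at [h = 1] makes it
     false. *)
  have /andP[alpha_u _] := sat _ Hu.
  by have /andP[_] := sat _ H1; rewrite mul1g alpha_u.
apply: contrapT => notHu; apply: unsat.
(* The indicator function of the subgroup satisfies every translate. *)
exists (fun g => `[< subgroup_of ws g >]) => h Hh.
rewrite [cnf_true _ _]cnfE; apply/andP; split; first exact/asboolP.
apply/asboolPn => Hhu; apply: notHu.
(* If [h] and [h * evalw u] are both in the subgroup, so is [evalw u]. *)
by have := HM _ _ (HV _ Hh) Hhu; rewrite mulKg.
Qed.

End Reduction.

Theorem lemma24 (G : groupType) (S : {fset G}) :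
  generates S -> infinite_set [set: G]%classic ->
  many_one_reduces (subgroup_membership S) (co (ksat 2 S)).
Proof.
by move=> _ _; exists (@reduction G S);
  [exact: computable_reduction | exact: reductionP].
Qed.
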